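(* Let $n,k$ be integers such that $k\geq 2$ and $n\geq 5k+2$, and let $G$ be a tripartite graph with parts $A$, $B$ and $C$ such that $|A|=|B|=|C|=n$. Let $\alpha$, $\beta$ and $\gamma$ denote the edge densities of $G[A,B]$, $G[A,C]$ and $G[B,C]$, respectively. If $\alpha,\beta,\gamma$ is a $(k,n)$-cyclic triple, then $G$ contains $k$ vertex-disjoint triangles.
   Context: For a tripartite graph $G$ and two of its parts $X,Y$, $G[X,Y]$ denotes the bipartite graph consisting of the edges of $G$ between $X$ and $Y$; its edge density is $|E(G[X,Y])|/(|X||Y|)$. For reals $\alpha,\beta,\gamma\in[0,1]$ and integers $n>k\geq 1$, the triple $\alpha,\beta,\gamma$ is called a $(k,n)$-cyclic triple if all six of the following inequalities hold: $$\beta\left(\alpha-\tfrac{k-1}{n}\right)+\gamma>1,\qquad \alpha\left(\beta-\tfrac{k-1}{n}\right)+\gamma>1,$$ $$\gamma\left(\alpha-\tfrac{k-1}{n}\right)+\beta>1,\qquad \alpha\left(\gamma-\tfrac{k-1}{n}\right)+\beta>1,$$ $$\gamma\left(\beta-\tfrac{k-1}{n}\right)+\alpha>1,\qquad \beta\left(\gamma-\tfrac{k-1}{n}\right)+\alpha>1.$$ *)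

(* Defs.v *)
From mathcomp Require Import all_boot all_order all_algebra.

Set Implicit Arguments.
Unset Strict Implicit.
Unset Printing Implicit Defensive.

Import Order.TTheory GRing.Theory Num.Theory.
Local Open Scope ring_scope.

Record sgraph (T : finType) := SGraph {
  adj :> rel T;
  adj_sym : symmetric adj;
  adj_irrefl : irreflexive adj
}.

Definition independent (T : finType) (G : sgraph T) (X : {set T}) : Prop :=
  {in X &, forall x y, ~~ G x y}.

Definition tripartite (T : finType) (G : sgraph T) (A B C : {set T}) : Prop :=
  [/\ A :|: B :|: C = [set: T],
      [/\ [disjoint A & B], [disjoint A & C] & [disjoint B & C]]
    & [/\ independent G A, independent G B & independent G C]].

(* Edges are oriented from X to Y; when X and Y are disjoint, each edge of
   G[X, Y] is listed exactly once. *)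
Definition edges_between (T : finType) (G : sgraph T) (X Y : {set T}) :
    {set T * T} :=
  [set p in setX X Y | G p.1 p.2].

Definition density (R : realFieldType) (T : finType) (G : sgraph T)
    (X Y : {set T}) : R :=
  #|edges_between G X Y|%:R / (#|X|%:R * #|Y|%:R).

(* The first two conjuncts are the standing assumptions under which the notion
   is defined; the bounds in [0, 1] hold automatically for edge densities. *)
Definition cyclic_triple (R : realFieldType) (k n : nat) (a b c : R) : Prop :=
  let d : R := (k%:R - 1) / n%:R in
  [/\ (0 < k < n)%N,
      [/\ 0 <= a <= 1, 0 <= b <= 1 & 0 <= c <= 1],
      b * (a - d) + c > 1 /\ a * (b - d) + c > 1,
      c * (a - d) + b > 1 /\ a * (c - d) + b > 1
    & c * (b - d) + a > 1 /\ b * (c - d) + a > 1].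

Definition triangle (T : finType) (G : sgraph T) (S : {set T}) : Prop :=
  #|S| = 3%N /\ {in S &, forall x y, x != y -> G x y}.

Definition has_disjoint_triangles (T : finType) (G : sgraph T) (k : nat) :
    Prop :=
  exists F : {set {set T}},
    [/\ #|F| = k, {in F, forall S, triangle G S} & trivIset F].

(* Main.v *)
(** Take a largest packing of [t < k] disjoint triangles.  Repeatedly, as long as
    some vertex [a] of a packed triangle has a link, inside the unused vertices
    [R], that cannot be covered by [2s + 4] vertices, where [s] is the number of
    vertices removed so far, remove [a] and release the other two vertices of its
    triangle into [R].  The removed set [S] can always be exchanged for [s]
    disjoint triangles avoiding four prescribed vertices.  At the end there are
    [r = t - s] packed triangles, and in each of them either all three links have
    a cover by one vertex, or one link has a cover by [2s + 4] vertices and the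
    other two are empty; anything else would give a larger packing.  Deleting the
    edges inside the packing ([r^2] for each pair of parts) and the edges from its
    vertices to their covers (at most [r (2s + 4)]) leaves a triangle-free graph
    outside [S].

    In a triangle-free tripartite graph with densities [a], [b], [c] one of
    [ab + c], [ac + b], [bc + a] is at most [1] (Bondy, Shen, Thomasse and
    Thomasse).  If, say, [ab + c <= 1], adding back [S] and the deleted edges
    yields [alpha beta + gamma <= 1 + cost], and for [n >= 5k + 2] the cost is at
    most [max(alpha, beta) (k - 1) / n], against the cyclic inequalities. *)

Require Import Defs.
From mathcomp Require Import all_boot all_order all_algebra.
From mathcomp Require Import zify ring lra.

Set Implicit Arguments.
Unset Strict Implicit.
Unset Printing Implicit Defensive.

Import Order.TTheory GRing.Theory Num.Theory.

(** * Triangle-free tripartite graphs *)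

Section TwoPoints.
Local Open Scope ring_scope.
Variable R : realFieldType.
Implicit Types l x y m a b : R.

(* In the application [(x1, y1)] and [(x2, y2)] are the relative degrees of two
   vertices of [A] into [B] and [C], and [1 - m] is the density of [G[B, C]].
   Both inequalities survive raising [y2] to [1]; they are then linear in [y1],
   and eliminating [y1] leaves the positivity of [p * A1 + q * A0]. *)
Lemma two_point_half l x1 x2 y1 y2 m a b :
  0 <= x2 -> x2 <= x1 -> x1 <= 1 -> 0 <= y1 -> y1 <= y2 -> y2 <= 1 ->
  1 <= 2 * l -> l <= 1 ->
  a = l * x1 + (1 - l) * x2 -> b = l * y1 + (1 - l) * y2 ->
  x1 * y1 + x2 * (y2 - y1) <= m ->
  m < a * b -> m * a < a + b - 1 -> False.
Proof.
move=> x2_ge0 x21 x1_le1 y1_ge0 y12 y2_le1 l_half l_le1 aE bE Mm Fm Fa.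
have a_le_x1 : a <= x1.
  have : 0 <= (1 - l) * (x1 - x2) by apply: mulr_ge0; lra.
  by rewrite aE; nra.
have a_ge_x2 : x2 <= a.
  have : 0 <= l * (x1 - x2) by apply: mulr_ge0; lra.
  by rewrite aE; nra.
(* With [y2] raised to [1], the hypotheses [m < a * b] and [m * a < a + b - 1] yield
   [0 < p - y1 * q] and [0 < A0 + y1 * A1]. *)
pose p := (1 - l) * a - x2; pose q := x1 - x2 - l * a.
pose A0 := a * (1 - x2) - l; pose A1 := l - a * (x1 - x2).
have pq : p - q <= 0 by rewrite /p /q; lra.
have F1 : 0 < y2 * p - y1 * q by rewrite /p /q; rewrite bE in Fm; nra.
have p_gt0 : 0 < p.
  rewrite ltNge; apply/negP => p_le0.
  have : 0 <= (y2 - y1) * - p by apply: mulr_ge0; lra.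
  have : 0 <= y1 * (q - p) by apply: mulr_ge0; lra.
  nra.
have q_gt0 : 0 < q by lra.
have F1' : 0 < p - y1 * q.
  have : 0 <= (1 - y2) * p by apply: mulr_ge0; lra.
  nra.
have Fa' : (x1 * y1 + x2 * (y2 - y1)) * a < a + b - 1.
  apply: le_lt_trans Fa; apply: ler_wpM2r => //; lra.
have F2' : 0 < A0 + y1 * A1.
  have : 0 <= (1 - y2) * ((1 - l) - x2 * a).
    apply: mulr_ge0; first lra.
    have : 0 <= (1 - a) * (1 - l + x2) by apply: mulr_ge0; lra.
    by rewrite /p in p_gt0; nra.
  by rewrite /A0 /A1; rewrite bE in Fa'; nra.
have A0_le0 : A0 <= 0.
  have h1 : a <= l + (1 - l) * x2.
    have : 0 <= l * (1 - x1) by apply: mulr_ge0; lra.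
    by rewrite aE; nra.
  have h2 : (l + (1 - l) * x2) * (1 - x2) <= l.
    have : 0 <= x2 * (l - (1 - l) + (1 - l) * x2).
      apply: mulr_ge0 => //; have : 0 <= (1 - l) * x2 by apply: mulr_ge0; lra.
      lra.
    nra.
  have : a * (1 - x2) <= (l + (1 - l) * x2) * (1 - x2).
    by apply: ler_wpM2r => //; lra.
  by rewrite /A0; lra.
have A1_ge0 : 0 <= A1.
  have : 0 <= a * (1 - x1) by apply: mulr_ge0; lra.
  by rewrite /A0 in A0_le0; rewrite /A1; nra.
have W_gt0 : 0 < p * A1 + q * A0.
  have : 0 < q * (A0 + y1 * A1) by apply: mulr_gt0.
  have : 0 <= (p - y1 * q) * A1 by apply: mulr_ge0 => //; lra.
  nra.
(* Multiplied by [l], the quantity left after eliminating [y1] has the factor [1 - a]. The cofactor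
   [Q] is nonpositive, using [x1 <= 1] when [l <= a] and [0 < p] otherwise. *)
pose Q := a * (1 - l) * (a - l) - x2 * (a - l * (1 - l) * (1 + a)).
have WQ : l * (p * A1 + q * A0) = (1 - a) * Q.
  rewrite /p /q /A0 /A1 /Q aE; ring.
have Q_le0 : Q <= 0.
  have l1a : (1 - l) * (1 + a) <= 1.
    have : 0 <= (1 - l) * (1 - a) by apply: mulr_ge0; lra.
    nra.
  have [la|al] := leP l a.
    have h1 : a - l <= (1 - l) * x2.
      have : 0 <= l * (1 - x1) by apply: mulr_ge0; lra.
      by rewrite aE; nra.
    have h2 : a * (1 - l) * (a - l) <= a * (1 - l) * ((1 - l) * x2).
      by apply: ler_wpM2l => //; apply: mulr_ge0; lra.
    have h3 : 0 <= x2 * (l * (a - (1 - l))).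
      by apply: mulr_ge0 => //; apply: mulr_ge0; lra.
    by rewrite /Q; nra.
  have h1 : 0 <= p * (l - a) by apply: mulr_ge0; lra.
  have h2 : 0 <= x2 * (l - l * ((1 - l) * (1 + a))).
    apply: mulr_ge0 => //; rewrite subr_ge0; apply: ler_piMr; lra.
  by rewrite /Q; rewrite /p in h1; nra.
have : (1 - a) * Q <= 0 by apply: mulr_ge0_le0; lra.
rewrite -WQ; apply/negP; rewrite -ltNge; apply: mulr_gt0; lra.
Qed.

(** The case [l < 1/2] reduces to the previous one by exchanging the two coordinates and the two
    points, which preserves [x1 * y1 + x2 * (y2 - y1)]. *)
Lemma two_point l x1 x2 y1 y2 m a b :
  0 <= x2 -> x2 <= x1 -> x1 <= 1 -> 0 <= y1 -> y1 <= y2 -> y2 <= 1 ->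
  0 <= l -> l <= 1 ->
  a = l * x1 + (1 - l) * x2 -> b = l * y1 + (1 - l) * y2 ->
  x1 * y1 + x2 * (y2 - y1) <= m ->
  m < a * b -> m * a < a + b - 1 -> m * b < a + b - 1 -> False.
Proof.
move=> x2_ge0 x21 x1_le1 y1_ge0 y12 y2_le1 l_ge0 l_le1 aE bE Mm Fm Fa Fb.
have [l_half|l_half] := leP 1 (2 * l).
  exact: (@two_point_half l x1 x2 y1 y2 m a b).
by apply: (@two_point_half (1 - l) y2 y1 x2 x1 m b a) => //; nra.
Qed.

End TwoPoints.

Section Average.
Local Open Scope ring_scope.
Variables (R : realFieldType) (I : finType) (A : {set I}).
Implicit Types (x y : I -> R) (a b m : R).

(* If the barycentre (a, b) of a family of points lies below no chord of the
   family, summing the strict inequalities over all pairs of points on both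
   sides of the vertical line through it gives 0 < 0. *)
Lemma chord_above_barycentre x y a b : A != set0 ->
  \sum_(i in A) x i = #|A|%:R * a -> \sum_(i in A) y i = #|A|%:R * b ->
  (exists2 i, i \in A & x i = a /\ b <= y i) \/
  (exists i j, [/\ i \in A, j \in A, a < x i, x j <= a &
     0 <= (x i - a) * (y j - b) + (a - x j) * (y i - b)]).
Proof.
move=> A0 sx sy.
have sdx : \sum_(i in A) (x i - a) = 0.
  by rewrite sumrB sx sumr_const mulr_natl subrr.
have sdy : \sum_(i in A) (y i - b) = 0.
  by rewrite sumrB sy sumr_const mulr_natl subrr.
pose L := [pred i in A | x i <= a]; pose U := [pred i in A | a < x i].
have splitLU (F : I -> R) :
    \sum_(i in A) F i = \sum_(i | U i) F i + \sum_(j | L j) F j.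
  rewrite (bigID (fun i => a < x i)) /=; congr (_ + _).
  by apply: eq_bigl => i; rewrite -leNgt.
have [/existsP[i Ui]|/existsPn noU] := boolP [exists i, U i]; last first.
  left.
  have xE i : i \in A -> x i = a.
    move=> iA.
    have le0 j : j \in A -> 0 <= a - x j.
      by move=> jA; move: (noU j); rewrite /= jA /= -leNgt subr_ge0.
    have /eqP: \sum_(j in A) (a - x j) = 0.
      by rewrite sumrB sx sumr_const mulr_natl subrr.
    rewrite psumr_eq0 // => /allP /(_ i); rewrite mem_index_enum iA /=.
    by move=> /(_ isT); rewrite subr_eq0 => /eqP.
  have [/existsP[i /andP[iA yi]]|/existsPn ny] :=
    boolP [exists i, (i \in A) && (b <= y i)].
    by exists i => //; split=> //; exact: xE.
  have /set0Pn[i iA] := A0.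
  have : \sum_(j in A) (y j - b) < 0.
    rewrite (bigD1 i) //=.
    have h j : j \in A -> y j - b < 0.
      by move=> jA; move: (ny j); rewrite jA /= -ltNge subr_lt0.
    rewrite -[ltRHS]addr0; apply: ltr_leD; first exact: h.
    by apply: sumr_le0 => j /andP[jA _]; apply/ltW/h.
  by rewrite sdy ltxx.
right.
set f := fun i j => (x i - a) * (y j - b) + (a - x j) * (y i - b).
have [/existsP[k /existsP[j /and3P[/andP[kA xk] /andP[jA xj] h]]]|no] :=
  boolP [exists i, exists j, [&& U i, L j & 0 <= f i j]].
  by exists k, j.
exfalso.
have neg k j : U k -> L j -> f k j < 0.
  move=> Uk Lj; rewrite ltNge; apply/negP => h; move/negP: no; apply.
  by apply/existsP; exists k; apply/existsP; exists j; rewrite Uk Lj.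
have [/existsP[j Lj]|/existsPn noL] := boolP [exists j, L j]; last first.
  have : 0 < \sum_(k in A) (x k - a).
    have pos k : k \in A -> 0 < x k - a.
      by move=> kA; move: (noL k); rewrite /= kA /= -ltNge subr_gt0.
    have iA : i \in A by case/andP: Ui.
    rewrite (bigD1 i) //=; apply: ltr_pwDl; first exact: pos.
    by apply: sumr_ge0 => k /andP[kA _]; apply/ltW/pos.
  by rewrite sdx ltxx.
(* The deviations of [x] from [a] have the same total [W] on both sides of the line, so the double
   sum equals [W] times the sum of all [y i - b], which is [0]. *)
set W := \sum_(k | U k) (x k - a).
have WL : \sum_(k | L k) (a - x k) = W.
  have -> : \sum_(k | L k) (a - x k) = - \sum_(k | L k) (x k - a).
    by rewrite -sumrN; apply: eq_bigr => k _; rewrite opprB.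
  by apply/esym/eqP; rewrite -addr_eq0 -splitLU sdx.
have : \sum_(k | U k) \sum_(l | L l) f k l < 0.
  have rowneg k : U k -> \sum_(l | L l) f k l < 0.
    move=> Uk; rewrite (bigD1 j) //= -[ltRHS]addr0.
    apply: ltr_leD; first exact: neg.
    by apply: sumr_le0 => l /andP[Ll _]; apply/ltW/neg.
  rewrite (bigD1 i) //= -[ltRHS]addr0; apply: ltr_leD; first exact: rowneg.
  by apply: sumr_le0 => k /andP[Uk _]; apply/ltW/rowneg.
suff -> : \sum_(k | U k) \sum_(l | L l) f k l = 0 by rewrite ltxx.
under eq_bigr => k _ do rewrite big_split /= -mulr_sumr -mulr_suml.
rewrite big_split /= -mulr_suml -mulr_sumr WL -/W -mulrDr addrC.
by rewrite -splitLU sdy mulr0.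
Qed.

(** If all three alternatives fail, some point or chord passes on or above the barycentre. A point
    is excluded by the one-point bound. For a chord, raising [b] to its height keeps the three
    failures, since [0 <= a] and [m <= 1], and [two_point] refutes them. *)
Lemma barycentre_bound x y a b m : A != set0 ->
  (forall i, i \in A -> 0 <= x i <= 1) ->
  (forall i, i \in A -> 0 <= y i <= 1) ->
  0 <= m -> m <= 1 ->
  (forall i j, i \in A -> j \in A -> x j <= x i -> y i <= y j ->
     x i * y i + x j * (y j - y i) <= m) ->
  (forall i, i \in A -> x i * y i <= m) ->
  \sum_(i in A) x i = #|A|%:R * a -> \sum_(i in A) y i = #|A|%:R * b ->
  [\/ a * b <= m, a + b - 1 <= m * a | a + b - 1 <= m * b].
Proof.
move=> A0 x01 y01 m0 m1 pair single sx sy.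
have [ab|Fm] := leP (a * b) m; first by constructor 1.
have [h|Fa] := leP (a + b - 1) (m * a); first by constructor 2.
have [h|Fb] := leP (a + b - 1) (m * b); first by constructor 3.
exfalso.
have A_gt0 : 0 < #|A|%:R :> R by rewrite ltr0n card_gt0.
have a_ge0 : 0 <= a.
  rewrite -(pmulr_rge0 _ A_gt0) -sx; apply: sumr_ge0 => i iA.
  by case/andP: (x01 i iA).
have b_ge0 : 0 <= b.
  rewrite -(pmulr_rge0 _ A_gt0) -sy; apply: sumr_ge0 => i iA.
  by case/andP: (y01 i iA).
have [[i iA [xi yi]]|[i [j [iA jA xi xj h]]]] := chord_above_barycentre A0 sx sy.
  have := single i iA; rewrite xi.
  have : a * b <= a * y i by apply: ler_wpM2l.
  lra.
have /andP[xi0 xi1] := x01 i iA; have /andP[yi0 yi1] := y01 i iA.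
have /andP[xj0 xj1] := x01 j jA; have /andP[yj0 yj1] := y01 j jA.
(* The one-point bound forces [y i < b], and then the chord forces [b <= y j]: the two points are
   ordered as [two_point] requires. *)
have yib : y i < b.
  rewrite ltNge; apply/negP => byi; have := single i iA.
  have : a * b <= x i * y i by apply: ler_pM => //; exact: ltW.
  lra.
have yjb : b <= y j.
  rewrite leNgt; apply/negP => yjb.
  have : (x i - a) * (y j - b) < 0 by rewrite pmulr_rlt0; lra.
  have : (a - x j) * (y i - b) <= 0 by apply: mulr_ge0_le0; lra.
  lra.
have xij : 0 < x i - x j by lra.
pose l := (a - x j) / (x i - x j).
have lE : l * (x i - x j) = a - x j by rewrite /l divfK // gt_eqF.
have l_ge0 : 0 <= l by apply: divr_ge0; lra.
have l_le1 : l <= 1 by rewrite /l ler_pdivrMr // mul1r; lra.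
pose b' := l * y i + (1 - l) * y j.
have aE : a = l * x i + (1 - l) * x j by lra.
have bb' : b <= b'.
  rewrite -subr_ge0 -(pmulr_rge0 _ xij).
  suff -> : (x i - x j) * (b' - b) =
     (x i - a) * (y j - b) + (a - x j) * (y i - b) by [].
  rewrite /b' aE; ring.
have xji : x j <= x i by lra.
have yij : y i <= y j by lra.
apply: (@two_point R l (x i) (x j) (y i) (y j) m a b') => //.
- exact: pair.
- by apply: lt_le_trans Fm _; apply: ler_wpM2l.
- by apply: lt_le_trans Fa _; lra.
- have : 0 <= (1 - m) * (b' - b) by apply: mulr_ge0; lra.
  lra.
Qed.

End Average.

Section TriangleFree.
Local Open Scope ring_scope.
Variables (T : finType) (H : rel T).
Implicit Types A B C : {set T}.

Definition edges A B : {set T * T} := [set p in setX A B | H p.1 p.2].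

Lemma card_edges A B : #|edges A B| = (\sum_(x in A) #|[set y in B | H x y]|)%N.
Proof.
under eq_bigr => x _ do rewrite -sum1_card.
rewrite -sum1_card pair_big_dep /=; apply: eq_bigl => -[x y].
by rewrite !inE /= andbA.
Qed.

Lemma card_edges_sub A B : (#|edges A B| <= #|A| * #|B|)%N.
Proof.
by rewrite -cardsX; apply/subset_leq_card/subsetP => p; rewrite inE => /andP[].
Qed.

Definition edge_density (R : realFieldType) A B : R :=
  #|edges A B|%:R / (#|A|%:R * #|B|%:R).

(** For a vertex of [A], the product of its neighbourhoods in [B] and [C] contains no edge. Hence
    [1 - c] bounds the relative area of the union of any two such rectangles, and [barycentre_bound]
    applies with [m = 1 - c]. *)
Lemma triangle_free_density (R : realFieldType) A B C :
  A != set0 -> B != set0 -> C != set0 ->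
  (forall x y z, x \in A -> y \in B -> z \in C ->
     H x y -> H x z -> H y z -> False) ->
  let a := edge_density R A B in let b := edge_density R A C in
  let c := edge_density R B C in
  [\/ a * b + c <= 1, a * c + b <= 1 | b * c + a <= 1].
Proof.
move=> A0 B0 C0 tfree a b c.
have pos (X : {set T}) : X != set0 -> 0 < #|X|%:R :> R.
  by move=> X0; rewrite ltr0n card_gt0.
pose NB x := [set y in B | H x y]; pose NC x := [set y in C | H x y].
pose xx t : R := #|NB t|%:R / #|B|%:R; pose yy t : R := #|NC t|%:R / #|C|%:R.
have BC_gt0 : 0 < #|B|%:R * #|C|%:R :> R by apply: mulr_gt0; apply: pos.
have frac01 (X Y : {set T}) : Y != set0 -> X \subset Y ->
    0 <= (#|X|%:R / #|Y|%:R : R) <= 1.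
  move=> Y0 XY; rewrite divr_ge0 ?ler0n //=.
  by rewrite ler_pdivrMr ?pos // mul1r ler_nat subset_leq_card.
have missing s t : s \in A -> t \in A ->
    (#|edges B C| + (#|NB s| * #|NC s| + #|NB t| * #|NC t|) <=
     #|B| * #|C| + #|NB s :&: NB t| * #|NC s :&: NC t|)%N.
  move=> sA tA.
  rewrite -!cardsX -(cardsUI (setX (NB s) (NC s))).
  have -> : setX (NB s) (NC s) :&: setX (NB t) (NC t) =
            setX (NB s :&: NB t) (NC s :&: NC t).
    by apply/setP => -[u v]; rewrite !inE /= andbACA; do ?bool_congr.
  rewrite addnA leq_add2r -(cardsUI (edges B C)).
  have -> : edges B C :&: (setX (NB s) (NC s) :|: setX (NB t) (NC t)) = set0.
    apply/setP => -[u v]; rewrite !inE /=; apply/negP.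
    case/andP => /andP[/andP[uB vC] uv].
    by case/orP => /andP[/andP[_ su] /andP[_ sv]]; exact: (tfree _ u v _ uB vC su sv uv).
  rewrite cards0 addn0; apply/subset_leq_card/subsetP => -[u v].
  rewrite !inE /=; case/orP; first by case/andP=> /andP[-> ->].
  by case/orP => /andP[/andP[-> _] /andP[-> _]].
have cE : #|edges B C|%:R = c * (#|B|%:R * #|C|%:R).
  by rewrite /c /edge_density divfK // gt_eqF.
have xE t : #|NB t|%:R = xx t * #|B|%:R by rewrite /xx divfK // gt_eqF // pos.
have yE t : #|NC t|%:R = yy t * #|C|%:R by rewrite /yy divfK // gt_eqF // pos.
have pair i j : i \in A -> j \in A -> xx j <= xx i -> yy i <= yy j ->
    xx i * yy i + xx j * (yy j - yy i) <= 1 - c.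
  move=> iA jA _ _; have := missing i j iA jA.
  have : (#|NB i :&: NB j| * #|NC i :&: NC j| <= #|NB j| * #|NC i|)%N.
    by apply: leq_mul; apply: subset_leq_card; rewrite ?subsetIl ?subsetIr.
  rewrite -(leq_add2l (#|B| * #|C|)) => h /leq_trans /(_ h).
  rewrite -(ler_nat R) !natrD !natrM cE !xE !yE => {}h.
  rewrite -subr_ge0 -(pmulr_rge0 _ BC_gt0).
  lra.
have single i : i \in A -> xx i * yy i <= 1 - c.
  by move=> iA; have := pair i i iA iA (lexx _) (lexx _); rewrite subrr mulr0 addr0.
have c0 : 0 <= c by apply: divr_ge0 => //; exact: ltW.
have c1 : c <= 1.
  by rewrite /c /edge_density ler_pdivrMr // mul1r -natrM ler_nat card_edges_sub.
have sum_dens (X : {set T}) : X != set0 ->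
    \sum_(t in A) #|[set y in X | H t y]|%:R / #|X|%:R = #|A|%:R * edge_density R A X.
  move=> X0; rewrite -mulr_suml -natr_sum -card_edges /edge_density.
  by field; rewrite !gt_eqF ?pos.
have := @barycentre_bound R T A xx yy a b (1 - c) A0.
case.
- by move=> i _; apply: frac01 => //; apply/subsetP => ?; rewrite inE => /andP[].
- by move=> i _; apply: frac01 => //; apply/subsetP => ?; rewrite inE => /andP[].
- by lra.
- by lra.
- exact: pair.
- exact: single.
- exact: sum_dens.
- exact: sum_dens.
- by move=> h; constructor 1; lra.
- by move=> h; constructor 2; lra.
- by move=> h; constructor 3; lra.
Qed.

End TriangleFree.

Lemma card_edges_swap (T : finType) (H : rel T) (A B : {set T}) :
  #|edges H A B| = #|edges (fun x y => H y x) B A|.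
Proof.
rewrite -(card_imset _ (can_inj (@swap_pairK T T))).
apply: eq_card => -[x y]; rewrite !inE /=; apply/imsetP/idP => [[[u v]]|].
  by rewrite !inE /= => /andP[/andP[uA vB] uv] [-> ->]; rewrite uA vB.
by case/andP=> /andP[xB yA] yx; exists (y, x) => //; rewrite !inE /= yA xB.
Qed.

(** * The numerical estimate *)

Section Numeric.
Local Open Scope ring_scope.
Variable R : realFieldType.

(** If [a - e1] and [b - e2] are both positive, their product is at most [c * e]; otherwise one of
    the last two terms alone dominates [a * b]. *)
Lemma mul_sub_le_cost (a b c e e1 e2 : R) :
  0 <= a -> 0 <= b -> 0 <= e1 -> 0 <= e2 -> 0 <= c -> 0 <= e ->
  a - e1 <= c -> b - e2 <= e -> a * b <= c * e + e1 * b + e2 * a.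
Proof.
move=> a0 b0 e10 e20 c0 e0 ac be.
have ce : 0 <= c * e by apply: mulr_ge0.
have h1 : 0 <= e1 * b by apply: mulr_ge0.
have h2 : 0 <= e2 * a by apply: mulr_ge0.
have h3 : 0 <= e1 * e2 by apply: mulr_ge0.
have [a1|a1] := leP a e1.
  have : a * b <= e1 * b by apply: ler_wpM2r. lra.
have [b1|b1] := leP b e2.
  have : b * a <= e2 * a by apply: ler_wpM2r. lra.
have : (a - e1) * (b - e2) <= c * e by apply: ler_pM; lra.
lra.
Qed.

(* [sA], [sB], [sC] are the fractions of removed vertices in the parts, [r] is
   the size of the remaining packing divided by [n], [nu] is [1 / n], and [e1],
   [e2], [e3] are the densities of the deleted edges. *)
Lemma numeric_half (al be ga d p sA sB sC r nu e1 e2 e3 : R) :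
  0 <= be -> be <= al -> al <= 1 -> 0 <= ga -> ga <= 1 ->
  0 <= sA -> 0 <= sB -> 0 <= sC -> 0 <= r -> 0 <= nu ->
  0 <= e1 -> 0 <= e2 -> 0 <= e3 ->
  sA + sB + sC + r <= d -> d <= 1 / 2 ->
  5 * (r + (sA + sB + sC)) + 7 * nu <= 1 ->
  e1 + e2 <= r * (2 * r + 2 * (sA + sB + sC) + 4 * nu) ->
  e1 * be + e2 * al + e3 <=
    r * (r * (1 + al + be) + 2 * (sA + sB + sC) + 4 * nu) ->
  p = 1 - sA ->
  p * (al * be + ga - 1) <= p * (e1 * be + e2 * al + e3 + sB * be + sC * al)
    + sA * ((1 - al + e1) * be + (1 - be + e2) * al) ->
  1 < al * (be - d) + ga -> 1 < ga * (al - d) + be -> 1 < al * (ga - d) + be ->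
  False.
Proof.
move=> be0 beal al1 ga0 ga1 sA0 sB0 sC0 r0 nu0 e10 e20 e30 sd d2 n5.
move=> he12 hcost pE hmain c1 c2 c3.
have al0 : 0 <= al by lra.
pose s := sA + sB + sC.
have p_gt0 : 0 < p by lra.
have d0 : 0 <= d by lra.
have abd : 1 + d < al + be.
  have : 0 <= (1 - ga) * (1 + (al - d)).
    have : d <= al.
      rewrite leNgt; apply/negP => h.
      have : ga * (al - d) <= 0 by apply: mulr_ge0_le0; lra.
      lra.
    by move=> ?; apply: mulr_ge0; lra.
  have [h|h] := leP d al; last first.
    have : ga * (al - d) <= 0 by apply: mulr_ge0_le0; lra.
    lra.
  have : ga * (al - d) <= 1 * (al - d) by apply: ler_wpM2r; lra.
  lra.
have al2 : 1 / 2 < al by lra.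
pose K := e1 * be + e2 * al + e3.
have E12 : e1 * be + e2 * al <= (e1 + e2) * al.
  have : e1 * be <= e1 * al by apply: ler_wpM2l.
  lra.
have small : 2 * r + 2 * (sA + sB + sC) + 4 * nu <= 4 / 7 by lra.
have e12r : e1 + e2 <= r * (4 / 7).
  by apply: le_trans he12 _; apply: ler_wpM2l.
have e12ral : e1 * be + e2 * al <= r * (4 / 7) * al.
  by apply: le_trans E12 _; apply: ler_wpM2r.
have BC : sB * be + sC * al <= (sB + sC) * al.
  have : sB * be <= sB * al by apply: ler_wpM2l.
  lra.
(* The crude bound [d] on the cost already gives [1 < be * (1 + al)], hence
   [3 / 5 < al], which the sharper bound [d * al] needs. *)
have cost1 : al * be + ga - 1 <= d.
  have K1 : K <= r.
    apply: le_trans hcost _; rewrite -[leRHS]mulr1; apply: ler_wpM2l => //.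
    have : r * (1 + al + be) <= r * 3.
      by clear -r0 al1 beal; apply: ler_wpM2l; lra.
    lra.
  have BC1 : (sB + sC) * al <= sB + sC.
    by rewrite -[leRHS]mulr1; apply: ler_wpM2l; lra.
  have A1 : (1 - al + e1) * be + (1 - be + e2) * al <= p.
    have h1 : d <= al * be.
      have : al * (1 + d - al) <= al * be by apply: ler_wpM2l; lra.
      have : 0 <= (1 - al) * (al - d).
        by clear -al1 al2 d2; apply: mulr_ge0; lra.
      lra.
    have h2 : r * (4 / 7) * al <= r * (4/7) * 1.
      by clear -r0 al1; apply: ler_wpM2l; [apply: mulr_ge0|]; lra.
    have : 0 <= (1 - al) * (1 - be).
      by clear -beal al1; apply: mulr_ge0; lra.
    lra.
  have : sA * ((1 - al + e1) * be + (1 - be + e2) * al) <= sA * p.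
    by apply: ler_wpM2l.
  have h3 : p * (K + sB * be + sC * al) <= p * (r + sB + sC).
    by apply: ler_wpM2l; lra.
  rewrite -/K in hmain => h4.
  have : p * (al * be + ga - 1) <= p * (r + sB + sC + sA) by lra.
  rewrite ler_pM2l //; lra.
(* Multiply the crude bound by [al] and compare with [1 < al * (ga - d) + be]: the terms in [d]
   cancel. *)
have key : 0 < (1 - al) * (be * (1 + al) - 1).
  have : al * ga <= al * (1 - al * be + d) by apply: ler_wpM2l; lra.
  lra.
have bal : 1 < be * (1 + al).
  rewrite ltNge; apply/negP => h.
  have : (1 - al) * (be * (1 + al) - 1) <= 0.
    by clear -al1 h; apply: mulr_ge0_le0; lra.
  lra.
(* Since [be <= al], one has [1 < al * (1 + al)], whereas [3/5 * 8/5 = 24/25]. *)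
have al35 : 3 / 5 < al.
  have : be * (1 + al) <= al * (1 + al).
    by clear -beal al0; apply: ler_wpM2r; lra.
  move=> h; rewrite ltNge; apply/negP => h'.
  have : al * (1 + al) <= 3 / 5 * (1 + 3 / 5).
    by clear -h' al0; apply: ler_pM; lra.
  lra.
(* The bound [n5] multiplied by [1 + 2 * al] controls the bracket in [hcost]; [3 / 5 < al] and
   [nu <= 1 / 7] absorb the remainder. *)
have K2 : K <= r * al.
  apply: le_trans hcost _; apply: ler_wpM2l => //.
  have h1 : r * (1 + al + be) <= r * (1 + al + al).
    by clear -beal r0; apply: ler_wpM2l; lra.
  have h2 : (r + (s + 7 / 5 * nu)) * (1 + 2 * al) <= 1 / 5 * (1 + 2 * al).
    apply: ler_wpM2r; rewrite /s; lra.
  have h3 : (s + 7 / 5 * nu) * (1 + 2 * (3 / 5)) <= (s + 7 / 5 * nu) * (1 + 2 * al).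
    apply: ler_wpM2l; first by rewrite /s; lra. by lra.
  rewrite /s in h2 h3; lra.
have A2 : (1 - al + e1) * be + (1 - be + e2) * al <= p * al.
  have h1 : (al + be * (1 - 2 * al)) <= 4 / 5 * al.
    have : be * (1 + al) * (2 * al - 1) >= 1 * (2 * al - 1).
      by apply: ler_wpM2r; lra.
    have : 0 <= (1 - al) * (al - 3 / 5).
      by clear -al1 al35; apply: mulr_ge0; lra.
    move=> h2 h3; rewrite -subr_ge0 -(@pmulr_rge0 _ (1 + al)); last by lra.
    lra.
  have : (sA + r) * al <= 1 / 5 * al.
    by clear -n5 sB0 sC0 nu0 al0; apply: ler_wpM2r; lra.
  have : r * (4 / 7) * al <= r * al.
    by clear -r0 al0; apply: ler_wpM2r; lra.
  rewrite pE; lra.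
have h4 : sA * ((1 - al + e1) * be + (1 - be + e2) * al) <= sA * (p * al).
  by apply: ler_wpM2l.
have h5 : p * (K + sB * be + sC * al) <= p * (r * al + (sB + sC) * al).
  by apply: ler_wpM2l; lra.
have : p * (al * be + ga - 1) <= p * ((sA + sB + sC + r) * al).
  by rewrite -/K in hmain; lra.
rewrite ler_pM2l //.
have : (sA + sB + sC + r) * al <= d * al by apply: ler_wpM2r.
clear -c1; lra.
Qed.

(** The part with removed fraction [sA] is the one shared by the pairs with densities [al] and [be].
    Rescaling [a * b + c <= 1] to the full parts bounds [al * be + ga - 1] by a cost; the larger of
    [al] and [be] then takes the first place in [numeric_half]. *)
Lemma numeric_center (al be ga d sA sB sC r nu e1 e2 e3 m1 m2 m3 a b c : R) :
  0 <= al <= 1 -> 0 <= be <= 1 -> 0 <= ga <= 1 ->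
  0 <= a <= 1 -> 0 <= b <= 1 ->
  0 <= sA -> 0 <= sB -> 0 <= sC -> 0 <= r -> 0 <= nu ->
  0 <= m1 -> 0 <= m2 -> 0 <= m3 -> m1 + m2 + m3 <= r * (2 * (sA + sB + sC) + 4 * nu) ->
  e1 = r * r + m1 -> e2 = r * r + m2 -> e3 = r * r + m3 ->
  sA + sB + sC + r <= d -> d <= 1 / 2 ->
  5 * (r + (sA + sB + sC)) + 7 * nu <= 1 ->
  al <= 1 - (1 - a) * (1 - sA) * (1 - sB) + e1 ->
  be <= 1 - (1 - b) * (1 - sA) * (1 - sC) + e2 ->
  ga <= 1 - (1 - c) * (1 - sB) * (1 - sC) + e3 ->
  a * b + c <= 1 ->
  1 < al * (be - d) + ga -> 1 < be * (al - d) + ga ->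
  1 < ga * (al - d) + be -> 1 < al * (ga - d) + be ->
  1 < ga * (be - d) + al -> 1 < be * (ga - d) + al -> False.
Proof.
move=> /andP[al0 al1] /andP[be0 be1] /andP[ga0 ga1] /andP[a0 a1] /andP[b0 b1].
move=> sA0 sB0 sC0 r0 nu0 m10 m20 m30 hm e1E e2E e3E sd d2 n5 hal hbe hga abc.
move=> c1 c2 c3 c4 c5 c6.
have rr : 0 <= r * r by apply: mulr_ge0.
have e10 : 0 <= e1 by rewrite e1E addr_ge0.
have e20 : 0 <= e2 by rewrite e2E addr_ge0.
have e30 : 0 <= e3 by rewrite e3E addr_ge0.
have he12 : e1 + e2 <= r * (2 * r + 2 * (sA + sB + sC) + 4 * nu).
  by clear -hm e1E e2E m30; lra.
have hcost : e1 * be + e2 * al + e3 <=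
    r * (r * (1 + al + be) + 2 * (sA + sB + sC) + 4 * nu).
  have : m1 * be <= m1 by rewrite -[leRHS]mulr1 ler_wpM2l.
  have : m2 * al <= m2 by rewrite -[leRHS]mulr1 ler_wpM2l.
  by rewrite e1E e2E e3E; clear -hm; lra.
(* The hypotheses control [u] and [v] only through [p * u <= 1 - al + e1] and
   [p * v <= 1 - be + e2], so the cost inequality is multiplied by [p] below. *)
pose p := 1 - sA; pose u := (1 - a) * (1 - sB); pose v := (1 - b) * (1 - sC).
have p0 : 0 <= p by rewrite /p; clear -n5 sA0 sB0 sC0 r0 nu0; lra.
have q0 : 0 <= 1 - sB by clear -n5 sA0 sB0 sC0 r0 nu0; lra.
have w0 : 0 <= 1 - sC by clear -n5 sA0 sB0 sC0 r0 nu0; lra.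
have a0' : 0 <= 1 - a by rewrite subr_ge0.
have b0' : 0 <= 1 - b by rewrite subr_ge0.
have u0 : 0 <= u by exact: mulr_ge0.
have v0 : 0 <= v by exact: mulr_ge0.
have hu : p * u <= 1 - al + e1 by rewrite /p /u; clear -hal; lra.
have hv : p * v <= 1 - be + e2 by rewrite /p /v; clear -hbe; lra.
have hab : al * be <= (a * (1 - sB)) * (b * (1 - sC)) +
    (e1 + sB + sA * u) * be + (e2 + sC + sA * v) * al.
  apply: mul_sub_le_cost; rewrite ?addr_ge0 ?mulr_ge0 //.
    by move: hu; rewrite /p /u; clear; lra.
  by move: hv; rewrite /p /v; clear; lra.
have hc : a * b * ((1 - sB) * (1 - sC)) <= (1 - c) * ((1 - sB) * (1 - sC)).
  by apply: ler_wpM2r; [exact: mulr_ge0 | clear -abc; lra].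
have hsum : al * be + ga - 1 <=
    (e1 * be + e2 * al + e3 + sB * be + sC * al) + sA * (u * be + v * al) by clear -hab hc hga; lra.
have hmain : p * (al * be + ga - 1) <= p * (e1 * be + e2 * al + e3 + sB * be + sC * al)
    + sA * ((1 - al + e1) * be + (1 - be + e2) * al).
  have h1 : p * (u * be + v * al) <= (1 - al + e1) * be + (1 - be + e2) * al.
    have : p * u * be <= (1 - al + e1) * be by apply: ler_wpM2r.
    have : p * v * al <= (1 - be + e2) * al by apply: ler_wpM2r.
    clear; lra.
  by have := ler_wpM2l p0 hsum; have := ler_wpM2l sA0 h1; clear; lra.
have [beal|albe] := leP be al.
  by apply: (@numeric_half al be ga d p sA sB sC r nu e1 e2 e3).
apply: (@numeric_half be al ga d p sA sC sB r nu e2 e1 e3) => //;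
  clear -he12 hcost hmain sd n5 albe; lra.
Qed.

End Numeric.

(** * Exchanging vertices for triangles *)

Section Packings.
Variables (T : finType) (G : sgraph T).
Implicit Types (S X Y : {set T}) (P Q : {set {set T}}).

Definition triangleb S :=
  (#|S| == 3) && [forall x in S, forall y in S, (x != y) ==> G x y].

Lemma triangleP S : reflect (triangle G S) (triangleb S).
Proof.
apply: (iffP andP) => -[/eqP S3 h]; split=> //.
  move=> x y xS yS xy; move/forall_inP: h => /(_ x xS) /forall_inP /(_ y yS).
  by rewrite xy.
by apply/forall_inP => x xS; apply/forall_inP => y yS; apply/implyP; exact: h.
Qed.

Definition packing P := [forall S in P, triangleb S] && trivIset P.

Lemma packing_triangle P S : packing P -> S \in P -> triangle G S.
Proof. by case/andP => /forall_inP h _ /h /triangleP. Qed.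

Lemma packing_trivIset P : packing P -> trivIset P.
Proof. by case/andP. Qed.

Lemma packing0 : packing set0.
Proof.
apply/andP; split; first by apply/forall_inP => S; rewrite inE.
by apply/trivIsetP => S S'; rewrite inE.
Qed.

Lemma packingS P Q : P \subset Q -> packing Q -> packing P.
Proof.
move=> PQ /andP[/forall_inP h tQ]; rewrite /packing (trivIsetS PQ tQ) andbT.
by apply/forall_inP => S /(subsetP PQ); apply: h.
Qed.

Lemma packing1 S : triangle G S -> packing [set S].
Proof.
move=> hS; apply/andP; split.
  by apply/forall_inP => X; rewrite inE => /eqP ->; apply/triangleP.
by apply/trivIsetP => X Y; rewrite !inE => /eqP -> /eqP ->; rewrite eqxx.
Qed.

Lemma card_cover_packing P : packing P -> #|cover P| = #|P| * 3.
Proof.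
move=> hP; have := packing_trivIset hP; rewrite /trivIset => /eqP <-.
under eq_bigr => S SP do have [-> _] := packing_triangle hP SP.
by rewrite sum_nat_const.
Qed.

Lemma packingU P Q : packing P -> packing Q -> [disjoint cover P & cover Q] ->
  packing (P :|: Q) /\ #|P :|: Q| = #|P| + #|Q|.
Proof.
move=> hP hQ PQ.
have disj X Y : X \in P -> Y \in Q -> [disjoint X & Y].
  move=> XP YQ; apply: disjointWl (bigcup_sup X XP) _.
  exact: disjointWr (bigcup_sup Y YQ) _.
split; last first.
  apply/eqP; rewrite (leq_card_setU P Q) -setI_eq0.
  apply/eqP/setP => X; rewrite !inE; apply/negP => /andP[XP XQ].
  have := disj X X XP XQ; rewrite -setI_eq0 setIid => /eqP X0.
  by have [] := packing_triangle hP XP; rewrite X0 cards0.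
apply/andP; split.
  apply/forall_inP => X; rewrite inE => /orP[] XP; apply/triangleP.
    exact: packing_triangle hP XP.
  exact: packing_triangle hQ XP.
apply/trivIsetP => X Y; rewrite !inE => /orP[] hX /orP[] hY XY.
- by have /trivIsetP := packing_trivIset hP; apply.
- exact: disj.
- by rewrite disjoint_sym; exact: disj.
- by have /trivIsetP := packing_trivIset hQ; apply.
Qed.

Lemma packing_has_disjoint_triangles k P :
  packing P -> k <= #|P| -> has_disjoint_triangles G k.
Proof.
move=> hP kP; pose F := [set S in take k (enum P)].
have FP : F \subset P.
  by apply/subsetP => S; rewrite inE => /mem_take; rewrite mem_enum.
have hF := packingS FP hP; exists F; split.
- by rewrite cardsE (card_uniqP _) ?take_uniq ?enum_uniq // size_takel // -cardE.
- by move=> S; apply: packing_triangle.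
- exact: packing_trivIset.
Qed.

Lemma triangle3 x y z : G x y -> G x z -> G y z -> triangle G [set x; y; z].
Proof.
have adj_neq u v : G u v -> u != v.
  by apply: contraTneq => ->; rewrite adj_irrefl.
move=> xy xz yz; split.
  by rewrite -setUA cardsU1 cards2 !inE negb_or !adj_neq.
move=> u v; rewrite !inE -!orbA => /or3P[] /eqP -> /or3P[] /eqP ->;
  by rewrite ?eqxx ?xy ?xz ?yz // adj_sym ?xy ?xz ?yz.
Qed.

(** A vertex cover of the link of [v] in [R], the graph of those edges inside [R] that form a
    triangle with [v]. *)
Definition link_cover v (R X : {set T}) :=
  [forall x in R, forall y in R,
     [&& G v x, G v y & G x y] ==> (x \in X) || (y \in X)].

Lemma link_coverPn v (R X : {set T}) : ~~ link_cover v R X ->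
  exists x y, [/\ x \in R, y \in R, G v x, G v y & G x y] /\
              x \notin X /\ y \notin X.
Proof.
case/forall_inPn => x xR /forall_inPn[y yR].
rewrite negb_imply negb_or => /andP[/and3P[vx vy xy] /andP[xX yX]].
by exists x, y.
Qed.

Definition rest S P := ~: (S :|: cover P).

(* Any four further vertices can be avoided when exchanging the removed set [S]
   for [#|S|] disjoint triangles, whence [S] counts as much as [#|S|] members
   of the packing. *)
Definition exchangeable S P := forall X, #|X| <= 4 -> [disjoint X & S] ->
  [disjoint X & cover P] ->
  exists Q, [/\ packing Q, #|Q| = #|S|, S \subset cover Q,
                [disjoint cover Q & cover P] & [disjoint cover Q & X]].

(** The invariant of the removal process: [t] is the size of the initial packing, and each removed
    vertex accounts for one released triangle. *)
Definition state t S P :=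
  [/\ packing P, [disjoint S & cover P], #|S| + #|P| = t & exchangeable S P].

Lemma cover_setD1 P X : packing P -> X \in P -> cover P = X :|: cover (P :\ X).
Proof. by move=> hP XP; rewrite /cover (big_setD1 X). Qed.

Lemma disjoint_setD1 P X : packing P -> X \in P -> [disjoint X & cover (P :\ X)].
Proof.
move=> hP XP; rewrite disjoints_subset; apply/subsetP => z zX; rewrite inE.
apply/bigcupP => -[Y]; rewrite !inE => /andP[YX YP] zY.
have /trivIsetP /(_ X Y XP YP) := packing_trivIset hP.
by rewrite eq_sym YX => /(_ isT) /disjointFr /(_ zX); rewrite zY.
Qed.

Lemma state_step t S P X a : state t S P -> X \in P -> a \in X ->
  (forall Y, #|Y| <= 2 * #|S| + 4 -> ~~ link_cover a (rest S P) Y) ->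
  state t (a |: S) (P :\ X).
Proof.
move=> [hP SP St ex] XP aX ncov.
have cP := cover_setD1 hP XP; have dX := disjoint_setD1 hP XP.
have aP : a \in cover P by rewrite cP inE aX.
have aS : a \notin S by rewrite (disjointFl SP aP).
split.
- exact: packingS (subsetDl _ _) hP.
- rewrite -setI_eq0 setIUl setU_eq0 !setI_eq0 disjoints1 (disjointFr dX aX) /=.
  by apply: disjointWr SP; rewrite cP subsetUr.
- by rewrite cardsU1 aS -St (cardsD1 X P) XP [RHS]addnCA addnA.
move=> Y Y4 YaS YP'.
have Ya : a \notin Y by rewrite (disjointFl YaS) // setU11.
have YS : [disjoint Y & S] by apply: disjointWr YaS; exact: subsetUr.
(* [Y] may meet the released triangle [X], which the old exchange property does not allow. As [Q]
   avoids [cover P], hence [X], avoiding [Y :\: X] is enough. *)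
have [||| Q [hQ Qs SQ QP QY]] := ex (Y :\: X).
- by apply: leq_trans Y4; apply: subset_leq_card; exact: subsetDl.
- by apply: disjointWl YS; exact: subsetDl.
- rewrite cP -setI_eq0 setIUr setU_eq0 setIC setIDA.
  rewrite setI_eq0 (disjointWl (subsetDl _ _) YP') andbT.
  by apply/eqP/setP => z; rewrite !inE; case: (z \in X); rewrite ?andbF.
(* [cover Q] has [3 * #|S|] vertices, [#|S|] of them in [S]; with at most four from [Y] this
   explains the threshold [2 * #|S| + 4]. *)
pose Z := (cover Q :\: S) :|: (Y :\: X).
have Zs : #|Z| <= 2 * #|S| + 4.
  apply: leq_trans (leq_card_setU _ _) _; apply: leq_add.
    rewrite cardsD (setIidPr SQ) (card_cover_packing hQ) Qs.
    by rewrite -{2}[#|S|]muln1 -mulnBr mulnC.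
  by apply: leq_trans Y4; apply: subset_leq_card; exact: subsetDl.
have [x [y [[xR yR ax ay xy] [xZ yZ]]]] := link_coverPn (ncov Z Zs).
have avoid z : z \in rest S P -> z \notin Z ->
    [/\ z \notin cover Q, z \notin Y, z \notin cover P & z \notin S].
  rewrite !inE !negb_or !negb_and !negbK => /andP[zS zP] /andP[].
  rewrite (negbTE zS) /= => zQ zY; split=> //.
  have zX : z \notin X by apply: contra zP; rewrite cP inE => ->.
  by move: zY; rewrite (negbTE zX).
have [xQ xY xP xS] := avoid x xR xZ; have [yQ yY yP yS] := avoid y yR yZ.
have aQ : a \notin cover Q by rewrite (disjointFl QP aP).
have hT := triangle3 ax ay xy.
have disj3 (U : {set T}) : a \notin U -> x \notin U -> y \notin U ->
    [disjoint [set a; x; y] & U].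
  move=> aU xU yU; rewrite disjoints_subset; apply/subsetP => z.
  by rewrite !inE -!orbA => /or3P[] /eqP ->.
have cover1 : cover [set [set a; x; y]] = [set a; x; y] by rewrite /cover big_set1.
have [|hQ' cQ'] := packingU (packing1 hT) hQ; first by rewrite cover1 disj3.
have cQ : cover ([set [set a; x; y]] :|: Q) = [set a; x; y] :|: cover Q.
  by rewrite /cover bigcup_setU big_set1.
have disjU (U V W : {set T}) : [disjoint U & W] -> [disjoint V & W] ->
    [disjoint U :|: V & W].
  by rewrite -!setI_eq0 setIUl setU_eq0 => -> ->.
exists ([set [set a; x; y]] :|: Q); split=> //.
- by rewrite cQ' cards1 cardsU1 aS Qs.
- by rewrite cQ; apply: setUSS => //; rewrite sub1set !inE eqxx.
- have PP : cover (P :\ X) \subset cover P by rewrite cP subsetUr.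
  rewrite cQ; apply: disjU; last exact: disjointWr PP QP.
  apply: disj3; first by rewrite (disjointFr dX aX).
    by apply: contra xP; apply/subsetP.
  by apply: contra yP; apply/subsetP.
- rewrite cQ; apply: disjU; first exact: disj3.
  rewrite disjoints_subset; apply/subsetP => z zQ; rewrite inE.
  apply/negP => zY; have zX : z \in X.
    by apply: contraT => zX; rewrite -(disjointFr QY zQ) !inE zX zY.
  by move: (disjointFr QP zQ); rewrite cP inE zX.
Qed.

(** Each removal step takes a triangle out of [P], so the process stops. *)
Lemma state_terminal t S P : state t S P ->
  exists S P, state t S P /\ (forall X a, X \in P -> a \in X ->
    exists2 Y : {set T}, #|Y| <= 2 * #|S| + 4 & link_cover a (rest S P) Y).
Proof.
move: {2}#|P| (leqnn #|P|) => m; elim: m S P => [|m IH] S P Pm hS.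
  exists S, P; split=> // X a XP.
  by move: Pm; rewrite leqn0 cards_eq0 => /eqP P0; rewrite P0 inE in XP.
have [/existsP[X /existsP[a /and3P[XP aX /forallP bad]]]|ok] := boolP
  [exists X, exists a, [&& X \in P, a \in X &
     [forall Y : {set T}, (#|Y| <= 2 * #|S| + 4) ==> ~~ link_cover a (rest S P) Y]]].
  apply: IH (state_step hS XP aX _); last by move=> Y; apply/implyP/bad.
  by move: Pm; rewrite (cardsD1 X) XP.
exists S, P; split=> // X a XP aX; move/existsPn: ok => /(_ X) /existsPn /(_ a).
rewrite XP aX /= => /forallPn[Y]; rewrite negb_imply negbK => /andP[? ?].
by exists Y.
Qed.

(* Replacing the subfamily [P0] of the packing by more triangles, and [S] by
   [#|S|] triangles, would contradict the maximality of [t]. *)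
Lemma state_augment t S P P0 Z :
  (forall Q, packing Q -> #|Q| <= t) -> state t S P ->
  P0 \subset P -> packing Z -> #|cover Z :&: rest S P| <= 4 ->
  cover Z \subset cover P0 :|: rest S P -> #|Z| <= #|P0|.
Proof.
move=> tmax [hP SP St ex] P0P hZ Z4 ZP.
have [|| Q [hQ Qs SQ QP QZ]] := ex _ Z4.
- rewrite disjoints_subset; apply/subsetP => z; rewrite !inE negb_or.
  by case/and3P.
- rewrite disjoints_subset; apply/subsetP => z; rewrite !inE negb_or.
  by case/and3P.
have P0c : cover P0 \subset cover P.
  by apply/bigcupsP => X XP; apply: bigcup_sup; exact: (subsetP P0P).
have hP' : packing (P :\: P0) by apply: packingS hP; exact: subsetDl.
have QP' : [disjoint cover Q & cover (P :\: P0)].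
  apply: disjointWr QP; apply/bigcupsP => X; rewrite inE => /andP[_ XP].
  exact: bigcup_sup.
have [hQP cQP] := packingU hQ hP' QP'.
have ZQP : [disjoint cover Z & cover (Q :|: P :\: P0)].
  rewrite disjoints_subset; apply/subsetP => z zZ; rewrite inE /cover bigcup_setU.
  rewrite inE negb_or; move/subsetP: ZP => /(_ z zZ); rewrite inE.
  case/orP => [zP0|zR].
    rewrite (disjointFl QP (subsetP P0c _ zP0)) /=.
    case/bigcupP: zP0 => X XP0 zX; apply/bigcupP => -[Y]; rewrite inE.
    case/andP => YP0 YP zY.
    have /trivIsetP /(_ X Y (subsetP P0P _ XP0) YP) := packing_trivIset hP.
    case: eqVneq => [XY|_ /(_ isT) XY]; first by rewrite -XY XP0 in YP0.
    by rewrite (disjointFr XY zX) in zY.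
  rewrite (disjointFl QZ) /=; last by rewrite inE zZ.
  move: zR; rewrite !inE negb_or.
  case/andP => _; apply: contra => /bigcupP[X]; rewrite inE => /andP[_ XP] zX.
  by apply/bigcupP; exists X.
have [hall call] := packingU hZ hQP ZQP.
have := tmax _ hall; rewrite call cQP Qs cardsD (setIidPr P0P) -St.
have := subset_leq_card P0P.
by move: #|Z| #|S| #|P0| #|P| => z s p0 p; clear; lia.
Qed.

End Packings.

(** * Triangles and the three colour classes *)

Section Coloured.
Variables (T : finType) (G : sgraph T) (col : T -> option bool).
Hypothesis colG : forall x y, G x y -> col x != col y.
Implicit Types (S X Y : {set T}) (P Q : {set {set T}}).

Definition part i : {set T} := [set x | col x == i].

Lemma triangle_col_inj X : triangle G X -> {in X &, injective col}.
Proof.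
move=> [_ h] x y xX yX cxy; apply/eqP; apply: contraT => xy.
by have := colG (h x y xX yX xy); rewrite cxy eqxx.
Qed.

Lemma triangle_col X i : triangle G X -> exists2 x, x \in X & col x = i.
Proof.
move=> hX; have [X3 _] := hX.
have : i \in col @: X.
  suff -> : col @: X = setT by rewrite inE.
  apply/eqP; rewrite eqEcard subsetT cardsT card_option card_bool /=.
  by rewrite card_in_imset ?X3 //; exact: triangle_col_inj.
by case/imsetP => x xX ->; exists x.
Qed.

Lemma card_triangle_part X i : triangle G X -> #|X :&: part i| = 1.
Proof.
move=> hX; have [x xX <-] := triangle_col i hX.
apply/eqP/cards1P; exists x; apply/setP => y; rewrite !inE.
apply/andP/eqP => [[yX /eqP cyx]|->]; last by rewrite eqxx.
exact: triangle_col_inj hX _ _ yX xX cyx.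
Qed.

(** Each triangle meets each part exactly once. This limits the edges inside the packing to
    [#|P| * #|P|] for each pair of parts. *)
Lemma card_cover_part P i : packing G P -> #|cover P :&: part i| = #|P|.
Proof.
move=> hP; rewrite -sum1_card.
rewrite (eq_bigl (fun x => (x \in cover P) && (x \in part i))); last first.
  by move=> x; rewrite inE.
rewrite big_trivIset_cond ?(packing_trivIset hP) //=.
rewrite -sum1_card; apply: eq_bigr => X XP.
rewrite -[RHS](card_triangle_part i (packing_triangle hP XP)) -sum1_card.
by apply: eq_bigl => x; rewrite !inE.
Qed.

(** * Link covers and edge deletion when the removal process has stopped *)

Section Terminal.
Variables (t : nat) (S : {set T}) (P : {set {set T}}).
Hypothesis tmax : forall Q, packing G Q -> #|Q| <= t.
Hypothesis hS : state G t S P.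
Hypothesis terminal : forall X a, X \in P -> a \in X ->
  exists2 Y : {set T}, #|Y| <= 2 * #|S| + 4 & link_cover G a (rest S P) Y.

Let R := rest S P.
Let N := cover P.

(** Such a triangle would enlarge the packing without giving up any member: [state_augment] with
    [P0] empty. *)
Lemma rest_triangle_free x y z : x \in R -> y \in R -> z \in R ->
  G x y -> G x z -> G y z -> False.
Proof.
move=> xR yR zR xy xz yz; have hT := triangle3 xy xz yz.
have cT : cover [set [set x; y; z]] = [set x; y; z] by rewrite /cover big_set1.
have := state_augment tmax hS (sub0set P) (packing1 hT).
rewrite cT cards1 cards0 => h; suff: 1 <= 0 by [].
apply: h.
  apply: leq_trans (subset_leq_card (subsetIl _ _)) _.
  by case: hT => ->.
apply/subsetP => u hu; apply/setUP; right.
by case/setUP: hu => [/set2P[]|/set1P] ->.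
Qed.

Lemma no_two_triangles X a b x y u v : X \in P -> a \in X -> b \in X ->
  a != b -> x \in R -> y \in R -> u \in R -> v \in R ->
  G a x -> G a y -> G x y -> G b u -> G b v -> G u v ->
  x != u -> x != v -> y != u -> y != v -> False.
Proof.
move=> XP aX bX ab xR yR uR vR ax ay xy bu bv uv xu xv yu yv.
have hT1 := triangle3 ax ay xy; have hT2 := triangle3 bu bv uv.
have inN z : z \in X -> z \notin R.
  move=> zX; rewrite !inE negbK; apply/orP; right.
  by apply/bigcupP; exists X.
have neqR z w : z \in X -> w \in R -> z != w.
  by move=> /inN zR wR; apply: contraNneq zR => ->.
have c1 (W : {set T}) : cover [set W] = W by rewrite /cover big_set1.
have dis : [disjoint [set a; x; y] & [set b; u; v]].
  rewrite disjoints_subset; apply/subsetP => z; rewrite !inE -!orbA.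
  by case/or3P => /eqP ->; rewrite !negb_or ?ab ?xu ?xv ?yu ?yv /= ?(neqR a)
    ?[_ == b]eq_sym ?(neqR b).
have [|hZ cZ] := packingU (packing1 hT1) (packing1 hT2); first by rewrite !c1.
have cov : cover ([set [set a; x; y]] :|: [set [set b; u; v]]) =
    [set a; x; y] :|: [set b; u; v] by rewrite /cover bigcup_setU !big_set1.
have P0P : [set X] \subset P by rewrite sub1set.
have := state_augment tmax hS P0P hZ; rewrite cZ cov c1 !cards1 => h.
suff: 1 + 1 <= 1 by [].
apply: h.
  have sub : ([set a; x; y] :|: [set b; u; v]) :&: R \subset [set x; y] :|: [set u; v].
    apply/subsetP => z; rewrite in_setI => /andP[hz zR]; move: hz; rewrite !inE.
    case/orP => /orP[/orP[]|] /eqP zE; subst z; rewrite ?eqxx ?orbT //.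
      by move: (inN _ aX); rewrite zR.
    by move: (inN _ bX); rewrite zR.
  apply: leq_trans (subset_leq_card sub) _.
  apply: leq_trans (leq_card_setU _ _) _.
  by rewrite !cards2; do 2 case: eqP.
apply/subsetP => z hz; apply/setUP.
by case/setUP: hz => /setUP[/set2P[]|/set1P] ->;
  [left|right|right|left|right|right].
Qed.

Definition lcov v : {set T} := [arg min_(X < [set: T] | link_cover G v R X) #|X|].

Lemma lcovP v : link_cover G v R (lcov v).
Proof.
rewrite /lcov; case: arg_minnP => //.
by apply/forall_inP => x _; apply/forall_inP => y _; rewrite !inE implybT.
Qed.

Lemma lcov_min v X : link_cover G v R X -> #|lcov v| <= #|X|.
Proof.
rewrite /lcov; case: arg_minnP => [|Y _ h /h //].
by apply/forall_inP => x _; apply/forall_inP => y _; rewrite !inE implybT.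
Qed.

(** Suppose the link of [b] has an edge. One end [p] has the colour of [a]; let [q] be the other
    end. As [q] alone does not cover the link of [a], that link has an edge missing [q], and it
    misses [p] as well because neighbours of [a] have other colours. The two triangles contradict
    [no_two_triangles]. *)
Lemma lcov_other X a b : X \in P -> a \in X -> b \in X -> a != b ->
  1 < #|lcov a| -> #|lcov b| = 0.
Proof.
move=> XP aX bX ab big; apply/eqP; rewrite -leqn0 -(cards0 T).
apply: lcov_min; apply: contraT => /link_coverPn.
move=> [x [y [[xR yR bx b_y xy] _]]]; exfalso.
have nocov w : ~~ link_cover G a R [set w].
  by apply: contraL big => /lcov_min; rewrite cards1 -leqNgt.
have key p q : p \in R -> q \in R -> G b p -> G b q -> G p q ->
    col p = col a -> False.
  move=> pR qR bp bq pq pa.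
  have [u [v [[uR vR au av uv] []]]] := link_coverPn (nocov q).
  rewrite !inE => uq vq.
  have neqp w : G a w -> w != p.
    by move=> aw; apply: contraTneq aw => ->; apply/negP => /colG; rewrite pa eqxx.
  by apply: (@no_two_triangles X a b u v p q) => //; apply: neqp.
have hX := packing_triangle (let: And4 h _ _ _ := hS in h) XP.
have ba : G b a by case: hX => _; apply=> //; rewrite eq_sym.
have [w] := triangle_col (col a) (triangle3 bx b_y xy).
rewrite !inE -!orbA => /or3P[] /eqP -> cw.
- by have := colG ba; rewrite cw eqxx.
- exact: (key x y).
- by apply: (key y x) => //; rewrite adj_sym.
Qed.

(** Either one vertex has a cover of size at least two, bounded by terminality while the other two
    links are empty, or all three covers have size at most one. *)
Lemma sum_lcov_triangle X : X \in P -> \sum_(v in X) #|lcov v| <= 2 * #|S| + 4.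
Proof.
move=> XP; have hX := packing_triangle (let: And4 h _ _ _ := hS in h) XP.
have [/existsP[a /andP[aX big]]|/existsPn small] :=
    boolP [exists a, (a \in X) && (1 < #|lcov a|)].
  rewrite (bigD1 a) //= big1 ?addn0; last first.
    by move=> b /andP[bX ba]; apply: (lcov_other XP aX bX) => //; rewrite eq_sym.
  by have [Y Ys hY] := terminal XP aX; exact: leq_trans (lcov_min hY) Ys.
apply: (@leq_trans (\sum_(v in X) 1)).
  by apply: leq_sum => v vX; have := small v; rewrite vX /= -leqNgt.
by rewrite sum1_card; case: hX => -> _; rewrite addnC.
Qed.

Lemma sum_lcov : \sum_(v in N) #|lcov v| <= #|P| * (2 * #|S| + 4).
Proof.
have hP : packing G P by case: hS.
rewrite big_trivIset ?(packing_trivIset hP) //= -sum_nat_const.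
by apply: leq_sum => X XP; exact: sum_lcov_triangle.
Qed.

(* Deleting the edges inside the packing and those from a vertex of the packing
   to the chosen cover of its link destroys all triangles outside [S]. *)
Definition pruned : rel T := fun x y =>
  [&& G x y, ~~ ((x \in N) && (y \in N)), (x \in N) ==> (y \notin lcov x)
    & (y \in N) ==> (x \notin lcov y)].

Lemma pruned_sym : symmetric pruned.
Proof.
move=> x y; rewrite /pruned adj_sym [(x \in N) && _]andbC.
by rewrite [X in _ && (_ && X)]andbC.
Qed.

(** A surviving triangle has at most one vertex [u] in the packing. If there is one, the opposite
    edge lies in the link of [u], so the cover of [u] contains one of its ends and the edge from [u]
    to that end was deleted. If there is none, [rest_triangle_free] applies. *)
Lemma pruned_triangle_free x y z : x \notin S -> y \notin S -> z \notin S ->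
  pruned x y -> pruned x z -> pruned y z -> False.
Proof.
have key u v w : u \in N -> v \notin S -> w \notin S ->
    pruned u v -> pruned u w -> pruned v w -> False.
  rewrite /pruned => uN vS wS; rewrite uN /=.
  case/and4P => uv vN vu _ /and4P[uw wN wu _] /and4P[vw _ _ _].
  have vR : v \in R by rewrite !inE negb_or vS.
  have wR : w \in R by rewrite !inE negb_or wS.
  have /forall_inP /(_ v vR) /forall_inP /(_ w wR) := lcovP u.
  by rewrite uv uw vw (negbTE vu) (negbTE wu).
move=> xS yS zS xy xz yz.
have [xN|xN] := boolP (x \in N); first exact: (key x y z).
have [yN|yN] := boolP (y \in N).
  by apply: (key y x z) => //; rewrite pruned_sym.
have [zN|zN] := boolP (z \in N).
  by apply: (key z x y) => //; rewrite pruned_sym.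
have inR u : u \notin S -> u \notin N -> u \in R by rewrite !inE negb_or => -> ->.
case/and4P: xy => xy _ _ _; case/and4P: xz => xz _ _ _; case/and4P: yz => yz _ _ _.
by apply: (rest_triangle_free (inR x xS xN) (inR y yS yN) (inR z zS zN)).
Qed.

Definition lcov_loss i j := \sum_(v in N :&: part i) #|lcov v :&: part j|.

(** An edge of [G] survives, lies inside the packing, joins a packed vertex to its cover, or meets
    [S]; the last kind is bounded by the number of all pairs meeting [S]. *)
Lemma card_edges_pruned i j :
  #|edges G (part i) (part j)| <=
  #|edges pruned (part i :\: S) (part j :\: S)| + #|P| * #|P| +
  (lcov_loss i j + lcov_loss j i) +
  (#|part i| * #|part j| - #|part i :\: S| * #|part j :\: S|).
Proof.
have hP : packing G P by case: hS.
pose L1 := [set p in setX (N :&: part i) (part j) | p.2 \in lcov p.1].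
pose L2 := [set p in setX (part i) (N :&: part j) | p.1 \in lcov p.2].
have cL1 : #|L1| = lcov_loss i j.
  rewrite (_ : L1 = edges (fun x y => y \in lcov x) (N :&: part i) (part j)) //.
  rewrite card_edges; apply: eq_bigr => v _; apply: eq_card => y.
  by rewrite !inE andbC.
have cL2 : #|L2| = lcov_loss j i.
  rewrite (_ : L2 = edges (fun x y => x \in lcov y) (part i) (N :&: part j)) //.
  rewrite card_edges_swap card_edges; apply: eq_bigr => v _; apply: eq_card => y.
  by rewrite !inE andbC.
have sub : edges G (part i) (part j) \subset
    edges pruned (part i :\: S) (part j :\: S) :|:
    setX (N :&: part i) (N :&: part j) :|: (L1 :|: L2) :|:
    (setX (part i) (part j) :\: setX (part i :\: S) (part j :\: S)).
  apply/subsetP => -[x y]; rewrite !inE /=.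
  case/andP => /andP[xi yj] xy; rewrite xi yj /pruned xy /=.
  by case: (x \in S); case: (y \in S); case: (x \in N); case: (y \in N);
     case: (x \in lcov y); case: (y \in lcov x).
apply: leq_trans (subset_leq_card sub) _.
apply: leq_trans (leq_card_setU _ _) _; apply: leq_add; last first.
  rewrite -!cardsX cardsD (setIidPr _) //.
  by apply/subsetP => -[x y]; rewrite !inE /= => /andP[/andP[_ ->] /andP[_ ->]].
apply: leq_trans (leq_card_setU _ _) _; apply: leq_add; last first.
  by apply: leq_trans (leq_card_setU _ _) _; rewrite cL1 cL2.
apply: leq_trans (leq_card_setU _ _) _; apply: leq_add => //.
by rewrite cardsX !card_cover_part.
Qed.

(** Splitting the packed vertices and their covers by colour gives nine terms, of which these are
    the six with distinct colours. *)
Lemma sum_lcov_loss : let L i j := lcov_loss i j + lcov_loss j i in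
  L None (Some true) + L None (Some false) + L (Some true) (Some false)
  <= #|P| * (2 * #|S| + 4).
Proof.
apply: leq_trans sum_lcov.
have split3 (F : T -> nat) (X : {set T}) : \sum_(v in X) F v =
    \sum_(v in X :&: part None) F v + (\sum_(v in X :&: part (Some true)) F v +
    \sum_(v in X :&: part (Some false)) F v).
  rewrite (bigID (fun v => col v == None)) /= [X in _ + X](bigID (fun v => col v == Some true)) /=.
  congr (_ + (_ + _)); apply: eq_bigl => v; rewrite !inE //.
  - by rewrite -andbA; case: (col v) => [[]|].
  - by rewrite -andbA; case: (col v) => [[]|].
have card3 (X : {set T}) : #|X| = #|X :&: part None| +
    (#|X :&: part (Some true)| + #|X :&: part (Some false)|).
  by rewrite -!sum1_card split3.
under [leqRHS]eq_bigr => v _ do rewrite card3.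
rewrite big_split /= big_split /= 3!(split3 _ N) -!/(lcov_loss _ _).
move: (lcov_loss None None) (lcov_loss None (Some true))
  (lcov_loss None (Some false)) (lcov_loss (Some true) None)
  (lcov_loss (Some true) (Some true)) (lcov_loss (Some true) (Some false))
  (lcov_loss (Some false) None) (lcov_loss (Some false) (Some true))
  (lcov_loss (Some false) (Some false)) => *.
clear; lia.
Qed.

End Terminal.
End Coloured.

(** * Conclusion *)

Lemma exists_max_packing (T : finType) (G : sgraph T) :
  exists2 P, packing G P & forall Q, packing G Q -> (#|Q| <= #|P|)%N.
Proof.
exists [arg max_(P > set0 | packing G P) #|P|].
  by case: arg_maxnP => //; exact: packing0.
by case: arg_maxnP => //; exact: packing0.
Qed.

Lemma state0 (T : finType) (G : sgraph T) P : packing G P -> state G #|P| set0 P.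
Proof.
move=> hP; split=> //; first by rewrite -setI_eq0 set0I.
  by rewrite cards0.
move=> X _ _ _; exists set0; split; rewrite ?sub0set ?cards0 //.
- exact: packing0.
- by rewrite /cover big_set0 -setI_eq0 set0I.
- by rewrite /cover big_set0 -setI_eq0 set0I.
Qed.

(** * Densities before and after removal and deletion *)

Section Density.
Local Open Scope ring_scope.
Variables (R : realFieldType) (T : finType).

Lemma edge_density01 (H : rel T) (A B : {set T}) :
  A != set0 -> B != set0 -> 0 <= edge_density H R A B <= 1.
Proof.
rewrite -!card_gt0 => A0 B0.
have AB : 0 < #|A|%:R * #|B|%:R :> R by rewrite mulr_gt0 ?ltr0n.
apply/andP; split; first by apply: divr_ge0 => //; exact: ltW.
by rewrite /edge_density ler_pdivrMr // mul1r -natrM ler_nat card_edges_sub.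
Qed.

(** The edge count divided by [n ^ 2], expressed through the non-edges of [H]: every pair meeting
    [S] is counted as an edge, so only non-edges outside [S] lower the bound. *)
Lemma density_transfer (G : sgraph T) (H : rel T) (A B S : {set T}) (n r l : nat) :
  #|A| = n -> #|B| = n -> A :\: S != set0 -> B :\: S != set0 ->
  (#|edges G A B| <= #|edges H (A :\: S) (B :\: S)| + r * r + l +
    (#|A| * #|B| - #|A :\: S| * #|B :\: S|))%N ->
  density R G A B <=
    1 - (1 - edge_density H R (A :\: S) (B :\: S)) *
      (1 - #|A :&: S|%:R / n%:R) * (1 - #|B :&: S|%:R / n%:R) +
    (r%:R / n%:R * (r%:R / n%:R) + l%:R / n%:R ^+ 2).
Proof.
move=> An Bn A0 B0 h.
have n0 : 0 < n%:R :> R.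
  rewrite ltr0n -An; apply: leq_trans (subset_leq_card (subsetDl A S)).
  by rewrite card_gt0.
have nn : n%:R != 0 :> R by rewrite gt_eqF.
have frac (X : {set T}) : #|X| = n -> 1 - #|X :&: S|%:R / n%:R = #|X :\: S|%:R / n%:R :> R.
  move=> Xn; rewrite -[X in _ = X%:R / _](addKn #|X :&: S|) cardsID Xn.
  rewrite natrB; first by field.
  by rewrite -Xn subset_leq_card ?subsetIl.
rewrite (frac A An) (frac B Bn) /density /edge_density An Bn.
have a0 : #|A :\: S|%:R != 0 :> R by rewrite pnatr_eq0 cards_eq0.
have b0 : #|B :\: S|%:R != 0 :> R by rewrite pnatr_eq0 cards_eq0.
have -> : 1 - (1 - #|edges H (A :\: S) (B :\: S)|%:R / (#|A :\: S|%:R * #|B :\: S|%:R)) *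
    (#|A :\: S|%:R / n%:R) * (#|B :\: S|%:R / n%:R) +
    (r%:R / n%:R * (r%:R / n%:R) + l%:R / n%:R ^+ 2) =
  (#|edges H (A :\: S) (B :\: S)|%:R + r%:R * r%:R + l%:R +
    (n%:R * n%:R - #|A :\: S|%:R * #|B :\: S|%:R)) / (n%:R * n%:R) :> R.
  by field; rewrite nn a0 b0.
rewrite ler_pM2r ?invr_gt0 ?mulr_gt0 //.
move: h; rewrite -(ler_nat R) !natrD natrB; last first.
  by apply: leq_mul; rewrite subset_leq_card ?subsetDl.
by rewrite !natrM An Bn.
Qed.

End Density.

Theorem theorem1p3 (R : realFieldType) (n k : nat) (hk : 2 <= k)
    (hn : 5 * k + 2 <= n) (T : finType) (G : sgraph T) (A B C : {set T})
    (hG : tripartite G A B C) (hA : #|A| = n) (hB : #|B| = n) (hC : #|C| = n)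
    (hcyc : cyclic_triple k n (density R G A B) (density R G A C)
                              (density R G B C)) :
  has_disjoint_triangles G k.
Proof.
have [P hP Pmax] := exists_max_packing G.
have [kP|Pk] := leqP k #|P|; first exact: packing_has_disjoint_triangles hP kP.
exfalso.
case: hG => ABC [AB AC BC] [iA iB iC].
(* The colours [None], [Some true], [Some false] stand for [A], [B], [C]. *)
pose col x := if x \in A then None else Some (x \in B).
have inC x : x \notin A -> x \notin B -> x \in C.
  move=> xA xB; have : x \in [set: T] by rewrite inE.
  by rewrite -ABC !inE (negbTE xA) (negbTE xB).
have colG x y : G x y -> col x != col y.
  rewrite /col => xy; have [xA|xA] := boolP (x \in A).
    by have [yA|//] := boolP (y \in A); rewrite (negbTE (iA x y xA yA)) in xy.
  have [//|yA] := boolP (y \in A).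
  have [xB|xB] := boolP (x \in B).
    by have [yB|//] := boolP (y \in B); rewrite (negbTE (iB x y xB yB)) in xy.
  have [//|yB] := boolP (y \in B).
  by rewrite (negbTE (iC x y (inC x xA xB) (inC y yA yB))) in xy.
have pA : part col None = A.
  by apply/setP => x; rewrite inE /col; case: (x \in A).
have pB : part col (Some true) = B.
  apply/setP => x; rewrite inE /col; case: ifPn => [xA|_].
    by rewrite (disjointFr AB xA).
  by case: (x \in B).
have pC : part col (Some false) = C.
  apply/setP => x; rewrite inE /col; case: ifPn => [xA|xA].
    by rewrite (disjointFr AC xA).
  have [xB|xB] := boolP (x \in B); first by rewrite (disjointFr BC xB).
  by rewrite inC.
have [S [Q [hS term]]] := state_terminal (state0 hP).
have [_ _ SQ _] := hS.
have cE i j := card_edges_pruned colG hS i j.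
have cL := sum_lcov_loss colG Pmax hS term.
have tf := pruned_triangle_free Pmax hS.
move: cL => /=; set H := pruned G S Q in cE tf *.
set L := lcov_loss G col S Q in cE * => cL.
(* Fewer than [n] vertices are removed, so no part is exhausted and the densities outside [S] are
   meaningful. *)
have Sn : (#|S| < n)%N by move: SQ Pk hn; move: #|S| #|Q| #|P| => s q p; clear; lia.
have nonempty (X : {set T}) : #|X| = n -> X :\: S != set0.
  move=> Xn; rewrite -card_gt0 cardsD Xn subn_gt0; apply: leq_ltn_trans Sn.
  by rewrite subset_leq_card ?subsetIr.
have [A0 B0 C0] := And3 (nonempty A hA) (nonempty B hB) (nonempty C hC).
have cS : (#|A :&: S| + #|B :&: S| + #|C :&: S|)%N = #|S|.
  rewrite -[in RHS](setTI S) -ABC.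
  have dsj (X Y : {set T}) : [disjoint X & Y] ->
      #|(X :|: Y) :&: S| = (#|X :&: S| + #|Y :&: S|)%N.
    move=> XY; rewrite setIUl; apply/eqP; rewrite (leq_card_setU _ _).
    apply: disjointWl (subsetIl _ _) _; apply: disjointWr (subsetIl _ _) _.
    exact: XY.
  have ABdC : [disjoint A :|: B & C].
    by move: AC BC; rewrite -!setI_eq0 setIUl setU_eq0 => -> ->.
  by rewrite (dsj _ _ ABdC) (dsj _ _ AB).
have eAB := cE None (Some true); have eAC := cE None (Some false).
have eBC := cE (Some true) (Some false).
rewrite !(pA, pB, pC) in eAB eAC eBC.
have nz : (n%:R != 0 :> R)%R by rewrite pnatr_eq0; move: hn; clear; lia.
have n0 : (0 < n%:R :> R)%R by rewrite lt_def nz ler0n.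
have hal := density_transfer R hA hB A0 B0 eAB.
have hbe := density_transfer R hA hC A0 C0 eAC.
have hga := density_transfer R hB hC B0 C0 eBC.
have : forall x y z, x \in A :\: S -> y \in B :\: S -> z \in C :\: S ->
    H x y -> H x z -> H y z -> False.
  move=> x y z; rewrite !inE => /andP[xS _] /andP[yS _] /andP[zS _].
  exact: tf.
move/(triangle_free_density R A0 B0 C0) => /=.
set a := edge_density H R (A :\: S) _ in hal *.
set b := edge_density H R (A :\: S) _ in hbe *.
set c := edge_density H R (B :\: S) _ in hga *.
have a01 : (0 <= a <= 1)%R := edge_density01 R H A0 B0.
have b01 : (0 <= b <= 1)%R := edge_density01 R H A0 C0.
have c01 : (0 <= c <= 1)%R := edge_density01 R H B0 C0.
set sA : R := (#|A :&: S|%:R / n%:R)%R in hal hbe *.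
set sB : R := (#|B :&: S|%:R / n%:R)%R in hal hga *.
set sC : R := (#|C :&: S|%:R / n%:R)%R in hbe hga *.
set r : R := (#|Q|%:R / n%:R)%R in hal hbe hga.
set m1 : R := (_%:R / _ ^+ 2)%R in hal; set m2 : R := (_%:R / _ ^+ 2)%R in hbe.
set m3 : R := (_%:R / _ ^+ 2)%R in hga.
case: hcyc => _ [al01 be01 ga01] [c1 c2] [c3 c4] [c5 c6].
set al := density R G A B in hal al01 c1 c2 c3 c4 c5 c6.
set be := density R G A C in hbe be01 c1 c2 c3 c4 c5 c6.
set ga := density R G B C in hga ga01 c1 c2 c3 c4 c5 c6.
set d : R := ((_ - 1) / _)%R in c1 c2 c3 c4 c5 c6.
have k1 : (k%:R - 1 = k.-1%:R :> R)%R by rewrite -subn1 natrB // ltnW.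
have sd : (sA + sB + sC + r <= d)%R.
  rewrite /d k1 -!mulrDl ler_pM2r ?invr_gt0 // -!natrD ler_nat cS SQ.
  by rewrite -ltnS prednK //; apply: leq_trans hk.
have d2 : (d <= 1 / 2)%R.
  rewrite /d k1 ler_pdivrMr // mulrAC ler_pdivlMr // mul1r -natrM ler_nat.
  by move: hn; clear; lia.
(* The packing has at most [k - 1] triangles, and [5 * (k - 1) + 7 = 5 * k + 2 <= n]. *)
have n5 : (5 * (r + (sA + sB + sC)) + 7 * n%:R^-1 <= 1)%R.
  have -> : (r + (sA + sB + sC) = #|P|%:R / n%:R)%R.
    by rewrite -!mulrDl -!natrD cS addnC SQ.
  rewrite mulrA -mulrDl ler_pdivrMr // mul1r -natrM -natrD ler_nat.
  by move: hn Pk; move: #|P| => p; clear; lia.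
have mE : (m1 + m2 + m3 <= r * (2 * (sA + sB + sC) + 4 * n%:R^-1))%R.
  rewrite /r -!mulrDl -!natrD cS mulrA -mulrDl mulf_div -expr2 ler_pM2r; last first.
    by rewrite invr_gt0 exprn_gt0.
  by rewrite -!natrM -natrD -natrM ler_nat.
have sA0 : (0 <= sA)%R by apply: divr_ge0; rewrite ler0n.
have sB0 : (0 <= sB)%R by apply: divr_ge0; rewrite ler0n.
have sC0 : (0 <= sC)%R by apply: divr_ge0; rewrite ler0n.
have r0 : (0 <= r)%R by apply: divr_ge0; rewrite ler0n.
have nu0 : (0 <= n%:R^-1 :> R)%R by rewrite invr_ge0 ler0n.
have m10 : (0 <= m1)%R by apply: divr_ge0; rewrite ?exprn_ge0 ?ler0n.
have m20 : (0 <= m2)%R by apply: divr_ge0; rewrite ?exprn_ge0 ?ler0n.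
have m30 : (0 <= m3)%R by apply: divr_ge0; rewrite ?exprn_ge0 ?ler0n.
have sE1 : (sB + sA + sC = sA + sB + sC)%R by rewrite [(sB + sA)%R]addrC.
have sE2 : (sC + sA + sB = sA + sB + sC)%R by rewrite -addrA [LHS]addrC.
have mE1 : (m1 + m3 + m2 = m1 + m2 + m3)%R by rewrite addrAC.
have mE2 : (m2 + m3 + m1 = m1 + m2 + m3)%R by rewrite addrC addrA.
(* The three alternatives have [A], [B] and [C] as the part shared by the two multiplied densities;
   [mulrAC] brings the factor of that part to the front. *)
case=> [h|h|h].
- by apply: (@numeric_center R al be ga d sA sB sC r n%:R^-1%R _ _ _ m1 m2 m3 a b c).
- rewrite mulrAC in hal.
  by apply: (@numeric_center R al ga be d sB sA sC r n%:R^-1%R _ _ _ m1 m3 m2 a c b);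
     rewrite ?sE1 ?mE1.
- rewrite mulrAC in hbe; rewrite mulrAC in hga.
  by apply: (@numeric_center R be ga al d sC sA sB r n%:R^-1%R _ _ _ m2 m3 m1 b c a);
     rewrite ?sE2 ?mE2.
Qed.
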